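(* Let $M$ be a smooth oriented surface in $E^3$ without umbilic points and without critical points of its mean curvature $H$, with $\psi$ (a local smooth angle function), $\vartheta_i$, $\alpha_i$ as defined in the context, and let $\vartheta_{12}$ be the connection form associated to $(\vartheta_1,\vartheta_2)$. Assume that $$d\alpha_1=0,\qquad d\alpha_2=\alpha_1\wedge\alpha_2 .$$ Then $\psi$ is harmonic, i.e. $d*d\psi=0$, and moreover $d*\vartheta_{12}=0$.
   Context: Connection form: for linearly independent one-forms $\eta_1,\eta_2$ on a surface, the associated connection form $\eta_{12}$ is the unique one-form with $d\eta_1=\eta_{12}\wedge\eta_2$, $d\eta_2=\eta_1\wedge\eta_{12}$. The surface $M$ carries an orthonormal frame $e_1,e_2,e_3$ with $e_3$ the unit normal and $e_1,e_2$ along principal directions; $\omega_1,\omega_2$ is the coframe dual to $e_1,e_2$ and $\omega_{12}=h\omega_1+k\omega_2$ its connection form. The principal curvatures are $a>c$ (so $\omega_{13}=a\omega_1$, $\omega_{23}=c\omega_2$), $H=\frac12(a+c)$, $J=\frac12(a-c)>0$. By the Codazzi equations there are functions $u,v$ with $\frac{1}{a-c}da-h\omega_2=(u-k)\omega_1$ and $\frac1{a-c}dc-k\omega_1=(v-h)\omega_2$; equivalently, with the notation below, $dH=J\vartheta_1$ and $d\log J=\alpha_1+2*\omega_{12}$. The Hodge operator is $*\omega_1=\omega_2$, $*\omega_2=-\omega_1$. Set $A=\sqrt{u^2+v^2}>0$ (positive since $dH\neq0$), and let $\psi$ be a local smooth function with $u=A\cos\psi$, $v=A\sin\psi$. Define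 $\vartheta_1=u\omega_1+v\omega_2$, $\vartheta_2=-v\omega_1+u\omega_2$, $\alpha_1=u\omega_1-v\omega_2$, $\alpha_2=v\omega_1+u\omega_2$. *)

(* Defs.v *)
From HB Require Import structures.
From mathcomp Require Import all_boot all_order all_algebra.
From mathcomp Require Import all_classical all_reals all_analysis.
Set Implicit Arguments.
Unset Strict Implicit.
Unset Printing Implicit Defensive.
Import Order.TTheory GRing.Theory Num.Theory.
Import numFieldNormedType.Exports.
Local Open Scope classical_set_scope.
Local Open Scope ring_scope.

Section Smooth.
Variables (R : realType) (V : normedModType R).
Implicit Types (U : set 'rV[R]_2) (f : 'rV[R]_2 -> V).

Fixpoint Cn_on U (n : nat) f : Prop :=
  if n is m.+1 then
    (forall x, U x -> differentiable f x) /\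
    (forall xi : 'rV[R]_2, Cn_on U m (fun x => 'D_xi f x))
  else forall x, U x -> {for x, continuous f}.

Definition smooth_on U f : Prop := forall n, Cn_on U n f.

End Smooth.

(* The library norm of ['rV[R]_3] is the sup norm, hence this explicit
   Euclidean inner product. *)
Definition dotp (R : realType) (v w : 'rV[R]_3) : R :=
  \sum_(i < 3) v 0 i * w 0 i.

(* Indices are computed modulo 3 in the ring ['I_3]. *)
Definition cross (R : realType) (v w : 'rV[R]_3) : 'rV[R]_3 :=
  \row_(i < 3) (v 0 (i + 1) * w 0 (i + 2) - v 0 (i + 2) * w 0 (i + 1)).

(* A smooth oriented surface in [E^3]: an abstract smooth oriented 2-manifold,
   given by an oriented atlas, with a smooth immersion [position] into [R^3].
   For a chart [i], [local_coord i] is the coordinate map, meaningful on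
   [chart_dom i], and [local_param i] its inverse, meaningful on
   [local_coord i @` chart_dom i]. *)
Record oriented_surface (R : realType) := OrientedSurface {
  carrier :> topologicalType;
  carrier_hausdorff : hausdorff_space carrier;
  carrier_second_countable : @second_countable carrier;
  chart : Type;
  chart_dom : chart -> set carrier;
  local_coord : chart -> carrier -> 'rV[R]_2;
  local_param : chart -> 'rV[R]_2 -> carrier;
  position : carrier -> 'rV[R]_3;
  chart_dom_open : forall i, open (chart_dom i);
  chart_dom_cover : forall p, exists i, chart_dom i p;
  chart_image_open : forall i, open (local_coord i @` chart_dom i);
  local_coordK : forall i p, chart_dom i p ->
    local_param i (local_coord i p) = p;
  local_coord_continuous : forall i p, chart_dom i p ->
    {for p, continuous (local_coord i)};
  local_param_continuous : forall i x, (local_coord i @` chart_dom i) x ->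
    {for x, continuous (local_param i)};
  transition_smooth : forall i j,
    smooth_on (local_coord i @` (chart_dom i `&` chart_dom j))
      (local_coord j \o local_param i);
  transition_oriented : forall i j x,
    (local_coord i @` (chart_dom i `&` chart_dom j)) x ->
    0 < \det ('J (local_coord j \o local_param i) x);
  position_smooth : forall i,
    smooth_on (local_coord i @` chart_dom i) (position \o local_param i);
  position_immersion : forall i x, (local_coord i @` chart_dom i) x ->
    row_free ('J (position \o local_param i) x)
}.

Definition chart_image (R : realType) (M : oriented_surface R) (i : chart M) :
  set 'rV[R]_2 := local_coord i @` chart_dom i.

Definition lpar (R : realType) (M : oriented_surface R) (i : chart M) :
  'rV[R]_2 -> 'rV[R]_3 := @position R M \o local_param i.

(* Geometry of a parametrized piece [X]; tangent vectors are given by their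
   coordinate vectors [xi], so that ['D_xi X x] is the vector in [R^3]. *)
Section Parametrized.
Variables (R : realType) (X : 'rV[R]_2 -> 'rV[R]_3).
Implicit Types (x xi zeta : 'rV[R]_2).

Definition first_form x xi zeta : R := dotp ('D_xi X x) ('D_zeta X x).

(* The unit normal e_3 determined by the orientation of the coordinates. *)
Definition unit_normal x : 'rV[R]_3 :=
  let n := cross ('D_(delta_mx 0 0) X x) ('D_(delta_mx 0 1) X x) in
  (Num.sqrt (dotp n n))^-1 *: n.

(* [xi] is an eigenvector (or 0) of the shape operator [- d e_3] for [kappa];
   for a frame as below this is [omega_13 = a omega_1, omega_23 = c omega_2],
   where [omega_i3 = <d e_i, e_3> = - <e_i, d e_3>]. *)
Definition principal (kappa : R) x xi : Prop :=
  - 'D_xi unit_normal x = kappa *: 'D_xi X x.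

Definition orthonormal_pair x xi zeta : Prop :=
  [/\ first_form x xi xi = 1, first_form x zeta zeta = 1
    & first_form x xi zeta = 0].

Definition principal_frame (U : set 'rV[R]_2) (a c : 'rV[R]_2 -> R)
    (e1 e2 : 'rV[R]_2 -> 'rV[R]_2) : Prop :=
  [/\ smooth_on U e1, smooth_on U e2 &
    forall x, U x ->
      [/\ orthonormal_pair x (e1 x) (e2 x),
          cross ('D_(e1 x) X x) ('D_(e2 x) X x) = unit_normal x,
          principal (a x) x (e1 x)
        & principal (c x) x (e2 x)]].

End Parametrized.

Section Curvatures.
Variables (R : realType) (M : oriented_surface R).
Implicit Types (a c f : M -> R) (p : M).

Definition principal_curvatures a c : Prop :=
  forall (i : chart M) p, chart_dom i p ->
    c p <= a p /\
    exists xi zeta, [/\ orthonormal_pair (lpar i) (local_coord i p) xi zeta,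
      principal (lpar i) (a p) (local_coord i p) xi
    & principal (lpar i) (c p) (local_coord i p) zeta].

Definition umbilic_point a c p : Prop := a p = c p.

Definition mean_curvature a c p : R := (a p + c p) / 2.

(* By the chain rule the choice of the chart at [p] is irrelevant. *)
Definition critical_point f p : Prop :=
  exists2 i : chart M, chart_dom i p &
    forall xi : 'rV[R]_2, 'D_xi (f \o local_param i) (local_coord i p) = 0.

End Curvatures.

(* Differential forms on an open subset of the coordinate plane; a one-form
   takes a point and a vector, a two-form a point and two vectors. *)
Section Forms.
Variable R : realType.
Local Notation fct := ('rV[R]_2 -> R).
Local Notation form1 := ('rV[R]_2 -> 'rV[R]_2 -> R).
Local Notation form2 := ('rV[R]_2 -> 'rV[R]_2 -> 'rV[R]_2 -> R).
Implicit Types U : set 'rV[R]_2.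

Definition is_form1 U (eta : form1) : Prop :=
  (forall x, U x -> scalar (eta x)) /\
  (forall xi, smooth_on U (fun x => eta x xi)).

Definition d0 (f : fct) : form1 := fun x xi => 'D_xi f x.

(* No bracket term: [xi] and [zeta] are constant vector fields. *)
Definition d1 (eta : form1) : form2 := fun x xi zeta =>
  'D_xi (fun y => eta y zeta) x - 'D_zeta (fun y => eta y xi) x.

Definition wedge1 (eta theta : form1) : form2 := fun x xi zeta =>
  eta x xi * theta x zeta - eta x zeta * theta x xi.

Definition form2_eq U (Om Om' : form2) : Prop :=
  forall x, U x -> forall xi zeta, Om x xi zeta = Om' x xi zeta.

Definition closed_form1 U (eta : form1) : Prop :=
  form2_eq U (d1 eta) (fun _ _ _ => 0).

(* The one-form [f eta + g theta]. *)
Definition lc (f : fct) (eta : form1) (g : fct) (theta : form1) : form1 :=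
  fun x xi => f x * eta x xi + g x * theta x xi.

Definition dual_coframe U (e1 e2 : 'rV[R]_2 -> 'rV[R]_2)
    (w1 w2 : form1) : Prop :=
  [/\ is_form1 U w1, is_form1 U w2 &
    forall x, U x -> [/\ w1 x (e1 x) = 1, w1 x (e2 x) = 0,
                         w2 x (e1 x) = 0 & w2 x (e2 x) = 1]].

Definition connection_form U (eta1 eta2 eta12 : form1) : Prop :=
  [/\ is_form1 U eta12,
      form2_eq U (d1 eta1) (wedge1 eta12 eta2)
    & form2_eq U (d1 eta2) (wedge1 eta1 eta12)].

(* [w1, w2] being dual to [e1, e2], this is the linear operator with
   [star w1 = w2] and [star w2 = - w1]. *)
Definition star (e1 e2 : 'rV[R]_2 -> 'rV[R]_2)
    (w1 w2 eta : form1) : form1 := fun x xi =>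
  eta x (e1 x) * w2 x xi - eta x (e2 x) * w1 x xi.

Definition codazzi_functions U (a c h k : fct) (w1 w2 : form1) (u v : fct) :
    Prop :=
  forall x, U x -> forall xi,
    (a x - c x)^-1 * d0 a x xi - h x * w2 x xi = (u x - k x) * w1 x xi /\
    (a x - c x)^-1 * d0 c x xi - k x * w1 x xi = (v x - h x) * w2 x xi.

Definition theta1 (w1 w2 : form1) (u v : fct) : form1 := lc u w1 v w2.
Definition theta2 (w1 w2 : form1) (u v : fct) : form1 := lc (\- v) w1 u w2.
Definition alpha1 (w1 w2 : form1) (u v : fct) : form1 := lc u w1 (\- v) w2.
Definition alpha2 (w1 w2 : form1) (u v : fct) : form1 := lc v w1 u w2.

Definition angle_function U (u v psi : fct) : Prop :=
  smooth_on U psi /\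
  forall x, U x ->
    let A := Num.sqrt (u x ^+ 2 + v x ^+ 2) in
    u x = A * cos (psi x) /\ v x = A * sin (psi x).

Definition harmonic_fun U (e1 e2 : 'rV[R]_2 -> 'rV[R]_2)
    (w1 w2 : form1) (psi : fct) : Prop :=
  closed_form1 U (star e1 e2 w1 w2 (d0 psi)).

End Forms.

(* Main.v *)
(** Write the connection forms of [theta1 + i theta2 = A e^(-i psi) (w1 + i w2)]
   and [alpha1 + i alpha2 = A e^(i psi) (w1 + i w2)] by means of
   [w12 = h w1 + k w2]: they are [w12 + d psi + * d log A] and
   [w12 - d psi + * d log A].  The hypotheses on [alpha1] and [alpha2] say that
   the second one is [alpha2], and the Codazzi equations give
   [d log (a - c) = alpha1 + 2 * w12].  Since [* alpha2 = - alpha1], applying [*]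
   yields, with [G = log (a - c) - log (A ^ 2)],
     [* theta12 = d G]  and  [2 * d psi = d G + alpha1],
   and both right-hand sides are closed.  The functions [a], [c], [u], [v] are
   only assumed to exist pointwise; they are smooth because
   [e_3 = D_(e1) X x D_(e2) X], [a = - <D_(e1) e_3, D_(e1) X>],
   [c = - <D_(e2) e_3, D_(e2) X>], and [u], [v] are then read off the Codazzi
   equations. *)

Require Import Defs.
From HB Require Import structures.
From mathcomp Require Import all_boot all_order all_algebra.
From mathcomp Require Import all_classical all_reals all_analysis.
From mathcomp Require Import ring lra.
Set Implicit Arguments.
Unset Strict Implicit.
Unset Printing Implicit Defensive.
Import Order.TTheory GRing.Theory Num.Theory.
Import numFieldNormedType.Exports.
Local Open Scope classical_set_scope.
Local Open Scope ring_scope.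

(** * Symmetry of second derivatives *)

Section MixedDerivatives.
Variables (R : realType) (V : normedModType R).
Implicit Types (f : V -> R) (x xi zeta : V).

Lemma is_derive_line f x xi (s : R) :
  derivable f (x + s *: xi) xi ->
  is_derive s 1 (fun s => f (x + s *: xi)) ('D_xi f (x + s *: xi)).
Proof.
move=> fx.
have E : (fun h : R => h^-1 *: (f (x + (h *: 1 + s) *: xi) - f (x + s *: xi)))
    = (fun h : R => h^-1 *: (f (h *: xi + (x + s *: xi)) - f (x + s *: xi))).
  by apply/funext => h; rewrite scalerDl addrCA [h *: 1]mulr1.
by split; rewrite /derivable /derive E.
Qed.

(** The mean value theorem is applied twice: first to [phi], the difference in the direction [zeta]
    as a function of the step along [xi], then to the derivative ['D_xi f] along [zeta]. *)
Lemma second_difference f x xi zeta (t : R) : 0 < t ->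
  (forall y s1 s2, 0 <= s1 <= t -> 0 <= s2 <= t ->
     y = x + s1 *: xi + s2 *: zeta ->
     [/\ differentiable f y & differentiable ('D_xi f) y]) ->
  exists s1 s2, [/\ 0 <= s1 <= t, 0 <= s2 <= t &
    f (x + t *: xi + t *: zeta) - f (x + t *: xi) - f (x + t *: zeta) + f x =
    'D_zeta ('D_xi f) (x + s1 *: xi + s2 *: zeta) * t * t].
Proof.
move=> t0 df.
pose phi s := f (x + t *: zeta + s *: xi) - f (x + s *: xi).
pose dphi s := 'D_xi f (x + t *: zeta + s *: xi) - 'D_xi f (x + s *: xi).
have t00 : 0 <= t <= t by rewrite lexx ltW.
have z00 : 0 <= (0 : R) <= t by rewrite lexx ltW.
have phiP s : 0 <= s <= t -> is_derive s 1 phi (dphi s).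
  move=> st; apply: is_deriveB; apply: is_derive_line; apply: diff_derivable.
    by have [] := df (x + t *: zeta + s *: xi) s t st t00 (addrAC _ _ _).
  by have [] := df (x + s *: xi) s 0 st z00; rewrite ?scale0r ?addr0.
have [| |s1 s1t E1] := @MVT_segment R phi dphi 0 t (ltW t0).
- by move=> s /[!in_itv]/= /andP[s0 st]; apply: phiP; rewrite !ltW.
- apply: derivable_within_continuous => s; rewrite in_itv/= => /phiP.
  by case.
rewrite in_itv/= in s1t.
pose psi s := 'D_xi f (x + s1 *: xi + s *: zeta).
pose dpsi s := 'D_zeta ('D_xi f) (x + s1 *: xi + s *: zeta).
have psiP s : 0 <= s <= t -> is_derive s 1 psi (dpsi s).
  move=> st; apply: is_derive_line; apply: diff_derivable.
  by have [] := df (x + s1 *: xi + s *: zeta) s1 s s1t st erefl.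
have [| |s2 s2t E2] := @MVT_segment R psi dpsi 0 t (ltW t0).
- by move=> s /[!in_itv]/= /andP[s0 st]; apply: psiP; rewrite !ltW.
- apply: derivable_within_continuous => s; rewrite in_itv/= => /psiP.
  by case.
rewrite in_itv/= in s2t.
exists s1, s2; split => //.
move: E1 E2; rewrite /phi /dphi /psi /dpsi !subr0 !scale0r !addr0.
rewrite [x + t *: zeta + s1 *: xi]addrAC => E1 E2.
rewrite E2 in E1; rewrite -E1 [x + t *: zeta + _]addrAC; ring.
Qed.

(** The second difference is symmetric in [xi] and [zeta], so dividing it by [t ^ 2] gives a value
    of each mixed derivative at points arbitrarily close to [x]. If the two limits at [x] were at
    distance [e], continuity within [e / 2] would contradict this. *)
Lemma mixed_derivatives_sym f x xi zeta :
  (\forall y \near x, [/\ differentiable f y, differentiable ('D_xi f) y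
                        & differentiable ('D_zeta f) y]) ->
  {for x, continuous ('D_zeta ('D_xi f))} ->
  {for x, continuous ('D_xi ('D_zeta f))} ->
  'D_zeta ('D_xi f) x = 'D_xi ('D_zeta f) x.
Proof.
move=> df c1 c2; apply/eqP; rewrite -subr_eq0 -normr_eq0; apply/negPn/negP => ne.
have tri (p q z d : R) : `|p - z| < d / 2 -> `|q - z| < d / 2 -> `|p - q| < d.
  rewrite (distrC q) => pz zq; rewrite -(subrKA z) (splitr d).
  by rewrite (le_lt_trans (ler_normD _ _))// ltrD.
set e := `|_| in ne.
have e0 : 0 < e / 2 by rewrite divr_gt0// lt_neqAle eq_sym ne /e normr_ge0.
move/cvgrPdist_lt : c1 => /(_ _ e0) c1; move/cvgrPdist_lt : c2 => /(_ _ e0) c2.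
have [r /= r0 rP] := (nbhs_ballP _ _).1 (filterI df (filterI c1 c2)).
(* The summand 1 keeps [K] positive when both vectors vanish; with [t * K = r / 2] the whole
   parallelogram of side parameters at most [t] lies in the ball of radius [r]. *)
pose K := `|xi| + `|zeta| + 1.
have K0 : 0 < K by rewrite /K ltr_wpDl// addr_ge0.
pose t := r / 2 / K.
have t0 : 0 < t by rewrite !divr_gt0.
have near_t s1 s2 : 0 <= s1 <= t -> 0 <= s2 <= t ->
    ball x r (x + s1 *: xi + s2 *: zeta).
  move=> /andP[s10 s1t] /andP[s20 s2t].
  rewrite -ball_normE/= -addrA opprD addrA subrr add0r normrN.
  rewrite (le_lt_trans (ler_normD _ _))// !normrZ !ger0_norm//.
  apply: (@le_lt_trans _ _ (t * K)).
    have [X Z] : 0 <= `|xi| /\ 0 <= `|zeta| by [].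
    rewrite /K; nra.
  by rewrite /t divfK ?gt_eqF// ltr_pdivrMr// ltr_pMr// ltr1n.
have [|s1 [s2 [s1t s2t E1]]] := @second_difference f x xi zeta t t0.
  by move=> y s1 s2 h1 h2 ->; have [[]] := rP _ (near_t _ _ h1 h2).
have [|s3 [s4 [s3t s4t E2]]] := @second_difference f x zeta xi t t0.
  move=> y s3 s4 h1 h2 ->; rewrite addrAC.
  by have [[]] := rP _ (near_t _ _ h2 h1).
have [_ [/= Y1 _]] := rP _ (near_t _ _ s1t s2t).
have [_ [/= _ Y2]] := rP _ (near_t _ _ s4t s3t).
rewrite (addrAC x (s4 *: xi)) in Y2.
set A := 'D_zeta _ _ in E1 Y1; set B := 'D_xi _ _ in E2 Y2.
have E : A = B.
  have tn : t != 0 by rewrite gt_eqF.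
  move: E1; rewrite [f _ - _ - _]addrAC [x + _ + _]addrAC E2.
  by clearbody A B => /(mulIf tn)/(mulIf tn).
rewrite -E in Y2.
by have := tri _ _ _ _ Y1 Y2; rewrite -/e ltxx.
Qed.

End MixedDerivatives.

(** * Calculus of smooth functions *)

Section SmoothFunctions.
Variables (R : realType) (U : set 'rV[R]_2).
Hypothesis U_open : open U.
Implicit Types f g : 'rV[R]_2 -> R.

Lemma open_near (P : 'rV[R]_2 -> Prop) x :
  U x -> (forall y, U y -> P y) -> \forall y \near x, P y.
Proof.
by move=> Ux UP; apply: filterS (open_nbhs_nbhs (conj U_open Ux)) => y /UP.
Qed.

Section NormedTarget.
Variable V : normedModType R.
Implicit Types F G : 'rV[R]_2 -> V.

(** Functions with the same germ have the same first-order expansion, and uniqueness of the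
    differential identifies ['d G x] with ['d F x]. *)
Lemma near_eq_differentiable F G x :
  (\forall y \near x, F y = G y) -> differentiable F x -> differentiable G x.
Proof.
move=> FG dF; have /diff_locallyP[cdF EF] := dF.
have EG : G \o shift x = cst (G x) + 'd F x +o_ (0 : 'rV[R]_2) id.
  apply/eqaddoP => e e0; move/eqaddoP : EF => /(_ e e0).
  have : \forall h \near (0 : 'rV[R]_2), F (h + x) = G (h + x).
    by move: FG; rewrite (near_shift 0) subr0.
  apply: filterS2 => h /= FGh.
  by rewrite /= -(nbhs_singleton FG) !fctE /= FGh.
have dE := diff_unique cdF EG.
by apply/diff_locallyP; rewrite dE.
Qed.

(** Since [U] is open, equality on [U] is equality of germs at each of its points, hence passes to
    all derivatives. This allows each function below to be replaced by an explicit formula valid on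
    [U] only. *)
Lemma Cn_on_eq n F G : {in U, F =1 G} -> Cn_on U n F -> Cn_on U n G.
Proof.
elim: n F G => [|n IH] F G FG CF;
  have FGx x : U x -> \forall y \near x, F y = G y
    by move=> Ux; apply: (@open_near (fun y => F y = G y)) => // y /mem_set /FG.
  move=> x Ux; rewrite /prop_for /continuous_at -FG; last exact/mem_set.
  apply: cvg_trans (CF _ Ux); apply: (@near_eq_cvg _ _ (nbhs x)); exact: FGx.
case: CF => dF CF; split=> [x Ux|xi].
  by apply: near_eq_differentiable (FGx _ Ux) _; exact: dF.
apply: IH (CF xi) => x /set_mem Ux; apply: near_eq_derive; exact: FGx.
Qed.

Lemma Cn_onW n F : Cn_on U n.+1 F -> Cn_on U n F.
Proof.
elim: n F => [|n IH] F [dF CF].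
  by move=> x Ux; apply: differentiable_continuous; exact: dF.
by split=> // xi; apply: IH; exact: CF.
Qed.

Lemma Cn_on_subset n (W : set 'rV[R]_2) F : U `<=` W -> Cn_on W n F -> Cn_on U n F.
Proof.
move=> UW; elim: n F => [|n IH] F /=.
  by move=> cF x /UW; exact: cF.
by move=> [dF CF]; split=> [x /UW|xi]; [exact: dF|exact: IH].
Qed.

Lemma smooth_on_eq F G : {in U, F =1 G} -> smooth_on U F -> smooth_on U G.
Proof. by move=> FG sF n; exact: Cn_on_eq FG (sF n). Qed.

Lemma smooth_on_subset (W : set 'rV[R]_2) F :
  U `<=` W -> smooth_on W F -> smooth_on U F.
Proof. by move=> UW sF n; exact: Cn_on_subset UW (sF n). Qed.

Lemma smooth_on_differentiable F x : smooth_on U F -> U x -> differentiable F x.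
Proof. by move=> sF; have [dF _] := sF 1; exact: dF. Qed.

Lemma smooth_on_derive F xi : smooth_on U F -> smooth_on U ('D_xi F).
Proof. by move=> sF n; have [_] := sF n.+1; apply. Qed.

Lemma smooth_on_cst (c : V) : smooth_on U (fun=> c).
Proof.
move=> n; elim: n c => [|n IH] c /=; first by move=> x _; exact: cst_continuous.
split=> [x _|xi]; first exact: differentiable_cst.
by apply: Cn_on_eq (IH 0) => x _; rewrite derive_cst.
Qed.

End NormedTarget.

Lemma smooth_on_coord m (F : 'rV[R]_2 -> 'rV[R]_m) i :
  smooth_on U F -> smooth_on U (fun x => F x 0 i).
Proof.
move=> sF n; elim: n F sF => [|n IH] F sF /=.
  move=> x Ux; apply: differentiable_continuous.
  apply: (@differentiable_comp _ _ _ _ F (fun M : 'rV_m => M 0 i)).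
    exact: smooth_on_differentiable.
  exact: differentiable_coord.
split=> [x Ux|xi].
  apply: (@differentiable_comp _ _ _ _ F (fun M : 'rV_m => M 0 i)).
    exact: smooth_on_differentiable.
  exact: differentiable_coord.
apply: Cn_on_eq (IH ('D_xi F) _); last exact: smooth_on_derive.
move=> x /set_mem Ux /=; rewrite derive_mx ?mxE//.
by apply: diff_derivable; exact: smooth_on_differentiable.
Qed.

Lemma Cn_onD n f g : Cn_on U n f -> Cn_on U n g -> Cn_on U n (fun x => f x + g x).
Proof.
elim: n f g => [|n IH] f g /=.
  by move=> cf cg x Ux; apply: continuousD; [exact: cf|exact: cg].
move=> [df Cf] [dg Cg]; split=> [x Ux|xi].
  by apply: differentiableD; [exact: df|exact: dg].
apply: Cn_on_eq (IH _ _ (Cf xi) (Cg xi)) => x /set_mem Ux.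
by rewrite [RHS]deriveD//; apply: diff_derivable; [exact: df|exact: dg].
Qed.

(** The Leibniz rule involves the factors themselves besides their derivatives, so the induction
    also uses that class [n.+1] implies class [n]. *)
Lemma Cn_onM n f g : Cn_on U n f -> Cn_on U n g -> Cn_on U n (fun x => f x * g x).
Proof.
elim: n f g => [|n IH] f g /=.
  by move=> cf cg x Ux; apply: continuousM; [exact: cf|exact: cg].
move=> Cf1 Cg1; have [Cf' Cg'] := (Cn_onW Cf1, Cn_onW Cg1).
have [df Cf] := Cf1; have [dg Cg] := Cg1; split=> [x Ux|xi].
  by apply: differentiableM; [exact: df|exact: dg].
apply: Cn_on_eq (Cn_onD (IH _ _ Cf' (Cg xi)) (IH _ _ Cg' (Cf xi))) => x /set_mem Ux.
by rewrite [RHS]deriveM//; apply: diff_derivable; [exact: df|exact: dg].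
Qed.

Lemma Cn_onV n f : (forall x, U x -> f x != 0) ->
  Cn_on U n f -> Cn_on U n (fun x => (f x)^-1).
Proof.
move=> f0; elim: n => [|n IH] /=.
  by move=> cf x Ux; apply: continuousV; [exact: f0|exact: cf].
move=> Cf1; have Cf' := IH (Cn_onW Cf1).
have [df Cf] := Cf1; split=> [x Ux|xi].
  by apply: differentiableV; [exact: df|exact: f0].
(* The derivative is written as a product in which [f^-1] occurs only through the induction
   hypothesis. *)
apply: Cn_on_eq (Cn_onM (smooth_on_cst (-1 : R) n) (Cn_onM (Cf xi) (Cn_onM Cf' Cf'))).
move=> x /set_mem Ux; rewrite [RHS]deriveV; last 2 first.
- exact: f0.
- by apply: diff_derivable; exact: df.
rewrite /GRing.scale/= expr2 invfM; ring.
Qed.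

Lemma smooth_onD f g :
  smooth_on U f -> smooth_on U g -> smooth_on U (fun x => f x + g x).
Proof. by move=> sf sg n; exact: Cn_onD. Qed.

Lemma smooth_onM f g :
  smooth_on U f -> smooth_on U g -> smooth_on U (fun x => f x * g x).
Proof. by move=> sf sg n; exact: Cn_onM. Qed.

Lemma smooth_onV f : (forall x, U x -> f x != 0) ->
  smooth_on U f -> smooth_on U (fun x => (f x)^-1).
Proof. by move=> f0 sf n; exact: Cn_onV. Qed.

Lemma smooth_onN f : smooth_on U f -> smooth_on U (fun x => - f x).
Proof.
move=> sf; apply: smooth_on_eq (smooth_onM (smooth_on_cst (-1 : R)) sf) => x _.
by rewrite mulN1r.
Qed.

Lemma smooth_onB f g :
  smooth_on U f -> smooth_on U g -> smooth_on U (fun x => f x - g x).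
Proof. by move=> sf sg; apply: smooth_onD sf (smooth_onN sg). Qed.

Lemma smooth_on_sum (I : Type) (r : seq I) (F : I -> 'rV[R]_2 -> R) :
  (forall i, smooth_on U (F i)) -> smooth_on U (fun x => \sum_(i <- r) F i x).
Proof.
move=> sF; elim: r => [|i r IH].
  by apply: smooth_on_eq (smooth_on_cst (0 : R)) => x _; rewrite big_nil.
by apply: smooth_on_eq (smooth_onD (sF i) IH) => x _; rewrite big_cons.
Qed.

Lemma derive_comp_real f (g : R -> R) (dg : R) x xi :
  differentiable f x -> is_derive (f x) 1 g dg ->
  differentiable (fun y => g (f y)) x /\
  'D_xi (fun y => g (f y)) x = dg * 'D_xi f x.
Proof.
move=> df gP; have dgx : differentiable g (f x).
  by apply/derivable1_diffP; case: gP.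
have dgf : differentiable (g \o f) x by exact: differentiable_comp.
split; first exact: dgf.
have E := @diff_comp _ _ _ _ f g x df dgx.
rewrite (deriveE _ dgf) [X in X xi = _]E [LHS]/= diff1E// derive1E.
by rewrite (@derive_val _ _ _ _ _ _ _ gP) deriveE// /GRing.scale/= mulrC.
Qed.

(** One differentiation suffices: the derivative [f^-1 * 'D_xi f] is already known to be smooth. *)
Lemma smooth_on_ln f : (forall x, U x -> 0 < f x) ->
  smooth_on U f -> smooth_on U (fun x => ln (f x)).
Proof.
move=> f0 sf [|n] /=.
  move=> x Ux; apply: differentiable_continuous.
  by have [] := derive_comp_real 0 (smooth_on_differentiable sf Ux)
    (is_derive1_ln (f0 _ Ux)).
split=> [x Ux|xi].
  by have [] := derive_comp_real 0 (smooth_on_differentiable sf Ux)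
    (is_derive1_ln (f0 _ Ux)).
have sV : smooth_on U (fun x => (f x)^-1).
  by apply: smooth_onV => // x Ux; rewrite gt_eqF// f0.
apply: Cn_on_eq (smooth_onM sV (smooth_on_derive xi sf) n).
move=> x /set_mem Ux.
by have [_ ->] := derive_comp_real xi (smooth_on_differentiable sf Ux)
  (is_derive1_ln (f0 _ Ux)).
Qed.

Lemma derive_rV2 f x xi : differentiable f x ->
  'D_xi f x = \sum_(j < 2) xi 0 j * 'D_(delta_mx 0 j) f x.
Proof.
move=> df; rewrite deriveE// {1}(row_sum_delta xi) linear_sum.
by apply: eq_bigr => j _; rewrite linearZ deriveE.
Qed.

(** [smooth_on] speaks of constant directions only; a direction varying with the point is expanded
    in the standard basis. *)
Lemma smooth_on_derive_field f (e : 'rV[R]_2 -> 'rV[R]_2) :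
  smooth_on U f -> smooth_on U e -> smooth_on U (fun x => 'D_(e x) f x).
Proof.
move=> sf se; apply: smooth_on_eq (smooth_on_sum _ _) => [x /set_mem Ux|j].
  by rewrite derive_rV2//; exact: smooth_on_differentiable sf Ux.
exact: smooth_onM (smooth_on_coord j se) (smooth_on_derive _ sf).
Qed.

Lemma smooth_on_mixed_derivatives f x xi zeta : smooth_on U f -> U x ->
  'D_xi ('D_zeta f) x = 'D_zeta ('D_xi f) x.
Proof.
move=> sf Ux; apply: mixed_derivatives_sym.
- apply: filterS (open_nbhs_nbhs (conj U_open Ux)) => y Uy.
  split; apply: smooth_on_differentiable Uy => //;
  exact: smooth_on_derive.
(* Order 0 of [smooth_on] is continuity. *)
- exact: (smooth_on_derive xi (smooth_on_derive zeta sf) 0).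
- exact: (smooth_on_derive zeta (smooth_on_derive xi sf) 0).
Qed.

End SmoothFunctions.

(** * Smoothness of the principal curvatures *)

Section PrincipalCurvature.
Variables (R : realType) (U : set 'rV[R]_2) (X : 'rV[R]_2 -> 'rV[R]_3).
Hypotheses (U_open : open U) (sX : smooth_on U X).
Implicit Types e : 'rV[R]_2 -> 'rV[R]_2.

Lemma derive_coord m (F : 'rV[R]_2 -> 'rV[R]_m) x xi i :
  (forall j, derivable (fun y => F y 0 j) x xi) ->
  'D_xi F x 0 i = 'D_xi (fun y => F y 0 i) x.
Proof.
by move=> dF; rewrite derive_mx ?mxE//; apply/derivable_mxP => j k; rewrite ord1.
Qed.

(** The hypothesis is made on the coordinates because the smoothness of the unit normal is
    established coordinate by coordinate. *)
Lemma derive_coord_smooth m (F : 'rV[R]_2 -> 'rV[R]_m) x xi i :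
  (forall j, smooth_on U (fun y => F y 0 j)) -> U x ->
  'D_xi F x 0 i = 'D_xi (fun y => F y 0 i) x.
Proof.
move=> sF Ux; apply: derive_coord => j.
by apply: diff_derivable; exact: smooth_on_differentiable (sF j) Ux.
Qed.

Lemma smooth_on_derive_field_coord m (F : 'rV[R]_2 -> 'rV[R]_m) e i :
  smooth_on U e -> (forall j, smooth_on U (fun y => F y 0 j)) ->
  smooth_on U (fun x => 'D_(e x) F x 0 i).
Proof.
move=> se sF; apply: (smooth_on_eq U_open) (smooth_on_derive_field U_open (sF i) se).
by move=> x /set_mem Ux; rewrite derive_coord_smooth.
Qed.

(** Expressing the normal as the cross product of the frame vectors makes it polynomial in the
    derivatives of [X], which avoids the normalizing square root. *)
Lemma smooth_unit_normal e1 e2 i : smooth_on U e1 -> smooth_on U e2 ->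
  (forall x, U x -> cross ('D_(e1 x) X x) ('D_(e2 x) X x) = unit_normal X x) ->
  smooth_on U (fun x => unit_normal X x 0 i).
Proof.
move=> se1 se2 N.
have sXe e j : smooth_on U e -> smooth_on U (fun x => 'D_(e x) X x 0 j).
  by move=> se; apply: smooth_on_derive_field_coord => // k; exact: smooth_on_coord.
apply: (smooth_on_eq U_open) (smooth_onB U_open
  (smooth_onM U_open (sXe _ (i + 1) se1) (sXe _ (i + 2) se2))
  (smooth_onM U_open (sXe _ (i + 2) se1) (sXe _ (i + 1) se2))).
by move=> x /set_mem Ux; rewrite -N// mxE.
Qed.

(** Pairing the eigenvector equation with the unit vector ['D_(e x) X x] isolates [kappa] as minus
    the inner product of the derivatives of the normal and of [X] along [e]. *)
Lemma smooth_principal_curvature (kappa : 'rV[R]_2 -> R) e :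
  smooth_on U e -> (forall i, smooth_on U (fun x => unit_normal X x 0 i)) ->
  (forall x, U x -> first_form X x (e x) (e x) = 1 /\
                    principal X (kappa x) x (e x)) ->
  smooth_on U kappa.
Proof.
move=> se sN kP.
have sXe j : smooth_on U (fun x => 'D_(e x) X x 0 j).
  by apply: smooth_on_derive_field_coord => // k; exact: smooth_on_coord.
have sNe j : smooth_on U (fun x => 'D_(e x) (unit_normal X) x 0 j).
  exact: smooth_on_derive_field_coord.
apply: (smooth_on_eq U_open) (smooth_onN U_open (smooth_on_sum U_open (index_enum 'I_3)
  (fun j => smooth_onM U_open (sNe j) (sXe j)))).
move=> x /set_mem Ux /=; have [one prin] := kP _ Ux.
rewrite -[RHS]mulr1 -one /first_form /dotp mulr_sumr -sumrN.
apply: eq_bigr => j _; rewrite -mulNr.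
have /(congr1 (fun v : 'rV[R]_3 => v 0 j)) := prin.
by rewrite !mxE => ->; rewrite mulrA.
Qed.

End PrincipalCurvature.

(** * Differential forms and moving frames *)

Section FrameForms.
Variables (R : realType) (U : set 'rV[R]_2).
Hypothesis U_open : open U.
Local Notation fct := ('rV[R]_2 -> R).
Local Notation form1 := ('rV[R]_2 -> 'rV[R]_2 -> R).
Implicit Types (f g : fct) (eta theta : form1).

Lemma scalar_row_sum m (l : 'rV[R]_m -> R) (z : 'rV[R]_m) : scalar l ->
  l z = \sum_(j < m) z 0 j * l (delta_mx 0 j).
Proof.
move=> ll.
pose l' : {scalar 'rV[R]_m} := HB.pack l (GRing.isLinear.Build _ _ _ _ _ ll).
rewrite -[l]/(l' : _ -> _) {1}[z]row_sum_delta linear_sum.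
by apply: eq_bigr => j _; rewrite linearZ.
Qed.

Lemma smooth_form1_field eta (e : 'rV[R]_2 -> 'rV[R]_2) :
  is_form1 U eta -> smooth_on U e -> smooth_on U (fun x => eta x (e x)).
Proof.
move=> [lin seta] se.
have sj j := smooth_onM U_open (smooth_on_coord U_open j se) (seta (delta_mx 0 j)).
apply: (smooth_on_eq U_open) (smooth_on_sum U_open (index_enum 'I_2) sj).
by move=> x /set_mem Ux /=; rewrite [RHS]scalar_row_sum//; exact: lin.
Qed.

Lemma closed_form1_eq eta theta :
  (forall x xi, U x -> eta x xi = theta x xi) ->
  closed_form1 U eta -> closed_form1 U theta.
Proof.
move=> E ceta x Ux xi zeta; rewrite -(ceta x Ux xi zeta) /d1.
congr (_ - _); apply: near_eq_derive.
  by apply: (open_near U_open Ux) => y /E ->.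
by apply: (open_near U_open Ux) => y /E ->.
Qed.

Lemma closed_d0 f : smooth_on U f -> closed_form1 U (d0 f).
Proof.
move=> sf x Ux xi zeta; rewrite /d1 /d0.
by rewrite (smooth_on_mixed_derivatives U_open xi zeta sf Ux) subrr.
Qed.

(** Serves to see that the half-sum of [d0 G] and [alpha1], which is [star] of the differential of
    [psi], is closed. *)
Lemma closed_form1_lc_cst (r s : R) eta theta :
  (forall xi, smooth_on U (fun x => eta x xi)) ->
  (forall xi, smooth_on U (fun x => theta x xi)) ->
  closed_form1 U eta -> closed_form1 U theta ->
  closed_form1 U (lc (cst r) eta (cst s) theta).
Proof.
move=> seta stheta ceta ctheta x Ux xi zeta.
have D xi' zeta' : 'D_xi' (fun y => lc (cst r) eta (cst s) theta y zeta') x =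
    r * 'D_xi' (fun y => eta y zeta') x + s * 'D_xi' (fun y => theta y zeta') x.
  have de : derivable (fun y => eta y zeta') x xi'.
    by apply: diff_derivable; exact: smooth_on_differentiable (seta _) Ux.
  have dt : derivable (fun y => theta y zeta') x xi'.
    by apply: diff_derivable; exact: smooth_on_differentiable (stheta _) Ux.
  have -> : (fun y => lc (cst r) eta (cst s) theta y zeta') =
      r *: (fun y => eta y zeta') + s *: (fun y => theta y zeta') by [].
  by rewrite (deriveD (derivableZ (k := r) de) (derivableZ (k := s) dt))
    (deriveZ r de) (deriveZ s dt).
have := ceta _ Ux xi zeta; have := ctheta _ Ux xi zeta.
rewrite /d1 !D => E1 E2.
by rewrite opprD addrACA -!mulrBr E1 E2 !mulr0 addr0.
Qed.

Lemma d1_lc f eta g theta x xi zeta :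
  differentiable f x -> differentiable g x ->
  (forall xi, differentiable (fun y => eta y xi) x) ->
  (forall xi, differentiable (fun y => theta y xi) x) ->
  d1 (lc f eta g theta) x xi zeta =
    wedge1 (d0 f) eta x xi zeta + f x * d1 eta x xi zeta +
    (wedge1 (d0 g) theta x xi zeta + g x * d1 theta x xi zeta).
Proof.
move=> df dg deta dtheta.
have D xi' zeta' : 'D_xi' (fun y => lc f eta g theta y zeta') x =
    f x * 'D_xi' (fun y => eta y zeta') x + eta x zeta' * 'D_xi' f x +
    (g x * 'D_xi' (fun y => theta y zeta') x + theta x zeta' * 'D_xi' g x).
  have -> : (fun y => lc f eta g theta y zeta') =
      f * (fun y => eta y zeta') + g * (fun y => theta y zeta') by [].
  have [F G] : derivable f x xi' /\ derivable g x xi'.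
    by split; exact: diff_derivable.
  have [H T] : derivable (eta ^~ zeta') x xi' /\ derivable (theta ^~ zeta') x xi'.
    by split; apply: diff_derivable; [exact: deta|exact: dtheta].
  by rewrite (deriveD (derivableM F H) (derivableM G T)) (deriveM F H) (deriveM G T).
rewrite /d1 !D /wedge1 /d0; ring.
Qed.

Variables (e1 e2 : 'rV[R]_2 -> 'rV[R]_2) (w1 w2 : form1).
Hypothesis coframe : dual_coframe U e1 e2 w1 w2.

(** The rows of [E] are the frame vectors and the columns of [W] the coframe. Duality says
    [E *m W = 1]; both being square, also [W *m E = 1], so [xi] is [xi *m W *m E], and pairing with
    [eta] gives the expansion. *)
Lemma form1_frameE eta x xi : U x -> scalar (eta x) ->
  eta x xi = eta x (e1 x) * w1 x xi + eta x (e2 x) * w2 x xi.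
Proof.
move=> Ux leta.
have [[l1 _] [l2 _] /(_ _ Ux)[w11 w12 w21 w22]] := coframe.
pose E := \matrix_(i < 2) (if i == 0 then e1 x else e2 x).
pose W := \matrix_(j < 2, i < 2)
  (if i == 0 then w1 x else w2 x) (delta_mx 0 j : 'rV[R]_2).
pose N := \col_(j < 2) eta x (delta_mx 0 j).
have EW : E *m W = 1%:M.
  apply/matrixP => i j; rewrite mxE.
  have -> : \sum_k E i k * W k j =
      (if j == 0 then w1 x else w2 x) (if i == 0 then e1 x else e2 x).
    rewrite [RHS]scalar_row_sum; last by case: ifP => _; [exact: l1|exact: l2].
    by apply: eq_bigr => k _; rewrite !mxE; case: ifP.
  by rewrite mxE; case: i j => [[|[]]//= ?] [[|[]]//= ?].
have xiW i : (xi *m W) 0 i = (if i == 0 then w1 x else w2 x) xi.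
  rewrite mxE [RHS]scalar_row_sum; last by case: ifP => _; [exact: l1|exact: l2].
  by apply: eq_bigr => k _; rewrite !mxE.
have EN i : (E *m N) i 0 = eta x (if i == 0 then e1 x else e2 x).
  rewrite mxE [RHS]scalar_row_sum//.
  by apply: eq_bigr => k _; rewrite !mxE; case: ifP.
have -> : eta x xi = (xi *m N) 0 0.
  by rewrite mxE scalar_row_sum//; apply: eq_bigr => k _; rewrite mxE.
rewrite -[xi in LHS]mulmx1 -(mulmx1C EW) mulmxA -mulmxA mxE.
by rewrite big_ord_recl big_ord1 !xiW !EN/= mulrC [X in _ + X]mulrC.
Qed.

End FrameForms.

(** * Structure equations in frame components *)

(** Here [u1], [u2], [v1], [v2] are the derivatives of [u] and [v] along [e1] and [e2], [p] and [q]
    are the components of [theta12], and [m1], [m2] are those of the differential of [ln n]. The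
    four equations are those for the exterior derivatives of [alpha1], [alpha2], [theta1], [theta2],
    in this order, evaluated at [(e1, e2)]. *)
Lemma frame_algebra (F : fieldType) (u v h k p q u1 u2 v1 v2 : F)
    (n := u ^+ 2 + v ^+ 2)
    (m1 := n^-1 * (2 * (u * u1 + v * v1))) (m2 := n^-1 * (2 * (u * u2 + v * v2))) :
  n != 0 -> (2 : F) != 0 ->
  - v1 - u2 + u * h - v * k = 0 -> u1 - v2 + v * h + u * k = n ->
  v1 - u2 + u * h + v * k = p * u + q * v ->
  u1 + v2 - v * h + u * k = u * q - v * p ->
  [/\ p = 2 * h - v - m2, q = 2 * k - u + m1,
      2 * (u * v1 - v * u1) = n * (p - v)
    & 2 * (u * v2 - v * u2) = n * (q - u)].
Proof.
move=> n0 two0 E1 E2 E3 E4.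
have M1 : n * m1 = 2 * (u * u1 + v * v1) by rewrite mulVKf.
have M2 : n * m2 = 2 * (u * u2 + v * v2) by rewrite mulVKf.
(* Each pair of equations is combined with coefficients [u] and [v] up to sign, a rotation scaled by
   the length of [(u, v)], so that [v], [u], [p] and [q] each appear alone with the factor [n]. *)
have A1 : u * (- v1 - u2 + u * h - v * k) + v * (u1 - v2 + v * h + u * k) = v * n.
  by rewrite E1 E2 mulr0 add0r.
have A2 : v * (- v1 - u2 + u * h - v * k) - u * (u1 - v2 + v * h + u * k) = - (u * n).
  by rewrite E1 E2 mulr0 add0r.
have A3 : u * (v1 - u2 + u * h + v * k) - v * (u1 + v2 - v * h + u * k) = p * n.
  by rewrite E3 E4 /n; ring.
have A4 : v * (v1 - u2 + u * h + v * k) + u * (u1 + v2 - v * h + u * k) = q * n.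
  by rewrite E3 E4 /n; ring.
have P1 : p = 2 * h - v - m2.
  apply: (mulfI n0); rewrite !mulrBr M2 [n * p]mulrC -A3 [n * v]mulrC -A1 /n; ring.
have Q1 : q = 2 * k - u + m1.
  apply: (mulfI n0); rewrite mulrDr mulrBr M1 [n * q]mulrC -A4 [n * u]mulrC.
  rewrite -[u * n]opprK -A2 /n; ring.
split=> //.
- rewrite [RHS]mulrBr [n * p]mulrC -A3 [n * v]mulrC -A1; ring.
- rewrite [RHS]mulrBr [n * q]mulrC -A4 [n * u]mulrC -[u * n]opprK -A2; ring.
Qed.

(** The relation [u * sin psi = v * cos psi] no longer contains the amplitude, so it can be
    differentiated without touching the square root; the amplitude reappears only when [u] and [v]
    are substituted afterwards. *)
Lemma derive_angle (R : realType) (U : set 'rV[R]_2) (u v psi : 'rV[R]_2 -> R)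
    x xi : open U -> smooth_on U u -> smooth_on U v -> angle_function U u v psi ->
  U x ->
  (u x ^+ 2 + v x ^+ 2) * 'D_xi psi x = u x * 'D_xi v x - v x * 'D_xi u x.
Proof.
move=> Uo su sv [spsi angle] Ux.
have [du dv] := (smooth_on_differentiable su Ux, smooth_on_differentiable sv Ux).
have dpsi := smooth_on_differentiable spsi Ux.
have [dsin Dsin] := derive_comp_real xi dpsi (is_derive_sin (psi x)).
have [dcos Dcos] := derive_comp_real xi dpsi (is_derive_cos (psi x)).
have E : 'D_xi (u * (fun y => sin (psi y))) x = 'D_xi (v * (fun y => cos (psi y))) x.
  apply: near_eq_derive; apply: (open_near Uo Ux) => y Uy.
  have [/=] := angle _ Uy; rewrite !fctE; set A := Num.sqrt _; clearbody A.
  by move=> -> ->; ring.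
rewrite (deriveM (diff_derivable du) (diff_derivable dsin)) in E.
rewrite (deriveM (diff_derivable dv) (diff_derivable dcos)) in E.
rewrite Dsin Dcos /GRing.scale/= in E.
have [/=] := angle _ Ux; set A := Num.sqrt _ => uA vA; clearbody A.
rewrite uA vA in E *.
set s := sin _ in E *; set c := cos _ in E *; set dv' := 'D_xi v x in E *.
have Ev : c * dv' = A * c * (c * 'D_xi psi x) + s * 'D_xi u x
    - A * s * (- s * 'D_xi psi x) by rewrite E; ring.
by rewrite -[A * c * dv']mulrA Ev; ring.
Qed.

(** By the structure equations, [h] and [k] are the values at [(e1, e2)] of the exterior derivatives
    of [w1] and [w2]; the rest is the Leibniz rule. *)
Lemma d1_lc_coframe (R : realType) (U : set 'rV[R]_2) (e1 e2 : 'rV[R]_2 -> 'rV[R]_2)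
    (w1 w2 : 'rV[R]_2 -> 'rV[R]_2 -> R) (f g h k : 'rV[R]_2 -> R) x :
  dual_coframe U e1 e2 w1 w2 -> connection_form U w1 w2 (lc h w1 k w2) ->
  smooth_on U f -> smooth_on U g -> U x ->
  d1 (lc f w1 g w2) x (e1 x) (e2 x) =
    'D_(e1 x) g x - 'D_(e2 x) f x + f x * h x + g x * k x.
Proof.
move=> [[_ sw1] [_ sw2] /(_ x) dual] [_ dw1 dw2] sf sg Ux.
have [w11 w12 w21 w22] := dual Ux.
rewrite d1_lc; last first.
- by move=> xi; exact: smooth_on_differentiable (sw2 xi) Ux.
- by move=> xi; exact: smooth_on_differentiable (sw1 xi) Ux.
- exact: smooth_on_differentiable sg Ux.
- exact: smooth_on_differentiable sf Ux.
rewrite dw1// dw2// /wedge1 /lc /d0 w11 w12 w21 w22; ring.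
Qed.

(** * Harmonicity of the angle and closedness of [star] of [theta12] *)

Theorem lemma4p1 (R : realType) (M : oriented_surface R)
  (a c : M -> R)
  (a_c_principal : principal_curvatures a c)
  (no_umbilic : forall p : M, ~ umbilic_point a c p)
  (no_critical : forall p : M, ~ critical_point (mean_curvature a c) p)
  (i : chart M) (U : set 'rV[R]_2) (U_open : open U)
  (U_sub : U `<=` chart_image i)
  (e1 e2 : 'rV[R]_2 -> 'rV[R]_2)
  (frame : principal_frame (lpar i) U
    (a \o local_param i) (c \o local_param i) e1 e2)
  (w1 w2 : 'rV[R]_2 -> 'rV[R]_2 -> R)
  (coframe : dual_coframe U e1 e2 w1 w2)
  (h k : 'rV[R]_2 -> R)
  (w12_conn : connection_form U w1 w2 (lc h w1 k w2))
  (u v : 'rV[R]_2 -> R)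
  (u_v_codazzi :
    codazzi_functions U (a \o local_param i) (c \o local_param i) h k w1 w2 u v)
  (psi : 'rV[R]_2 -> R) (psi_angle : angle_function U u v psi)
  (theta12 : 'rV[R]_2 -> 'rV[R]_2 -> R)
  (theta12_conn :
    connection_form U (theta1 w1 w2 u v) (theta2 w1 w2 u v) theta12)
  (dalpha1 : closed_form1 U (alpha1 w1 w2 u v))
  (dalpha2 : form2_eq U (d1 (alpha2 w1 w2 u v))
                        (wedge1 (alpha1 w1 w2 u v) (alpha2 w1 w2 u v))) :
  harmonic_fun U e1 e2 w1 w2 psi /\ closed_form1 U (star e1 e2 w1 w2 theta12).
Proof.
have [se1 se2 framex] := frame.
have [[lw1 sw1] [lw2 sw2] dual] := coframe.
pose a' := a \o local_param i; pose c' := c \o local_param i.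
have sX : smooth_on U (lpar i).
  by apply: smooth_on_subset U_sub _; exact: position_smooth.
have sN j : smooth_on U (fun x => unit_normal (lpar i) x 0 j).
  by apply: (smooth_unit_normal U_open sX _ se1 se2) => x /framex[].
have sa : smooth_on U a'.
  apply: (smooth_principal_curvature U_open sX se1 sN) => x Ux.
  by have [[one _ _] _ pa _] := framex _ Ux.
have sc : smooth_on U c'.
  apply: (smooth_principal_curvature U_open sX se2 sN) => x Ux.
  by have [[_ one _] _ _ pc] := framex _ Ux.
(* A point of [U] is the coordinate vector of a point of [M], where the ordering of [a] and [c] is
   strict for lack of umbilics. *)
have ac0 x : U x -> 0 < a' x - c' x.
  move=> /U_sub[p pi <-]; rewrite /a' /c' /= local_coordK//.
  have [le_ca _] := a_c_principal _ _ pi.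
  rewrite subr_gt0 lt_neqAle le_ca andbT.
  by apply/eqP => ca; exact: (no_umbilic p).
have ac_neq0 x : U x -> a' x - c' x != 0 by move=> Ux; rewrite gt_eqF// ac0.
have sac : smooth_on U (fun x => a' x - c' x) := smooth_onB U_open sa sc.
have sacV := smooth_onV U_open ac_neq0 sac.
have sw12 := w12_conn; case: sw12 => sw12 _ _.
have codazzi x xi (Ux : U x) :
  (a' x - c' x)^-1 * 'D_xi a' x - h x * w2 x xi = (u x - k x) * w1 x xi /\
  (a' x - c' x)^-1 * 'D_xi c' x - k x * w1 x xi = (v x - h x) * w2 x xi :=
  u_v_codazzi x Ux xi.
(* [h] and [k] are the values of the smooth connection form on [e1] and [e2]. *)
have sh : smooth_on U h.
  apply: (smooth_on_eq U_open) (smooth_form1_field U_open sw12 se1) => x /set_mem Ux.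
  by have [w11 w12 w21 w22] := dual _ Ux; rewrite /lc w11 w21; ring.
have sk : smooth_on U k.
  apply: (smooth_on_eq U_open) (smooth_form1_field U_open sw12 se2) => x /set_mem Ux.
  by have [w11 w12 w21 w22] := dual _ Ux; rewrite /lc w12 w22; ring.
(* The first Codazzi equation at [e1] gives [u], and the second at [e2] gives [v]. *)
have su : smooth_on U u.
  apply: (smooth_on_eq U_open) (smooth_onD U_open sk (smooth_onM U_open sacV
    (smooth_on_derive_field U_open sa se1))) => x /set_mem Ux.
  have [w11 w12 w21 w22] := dual _ Ux.
  have [+ _] := codazzi x (e1 x) Ux; rewrite w11 w21 !mulr0 mulr1 subr0 => E.
  by rewrite /= [X in _ + X]E; ring.
have sv : smooth_on U v.
  apply: (smooth_on_eq U_open) (smooth_onD U_open sh (smooth_onM U_open sacV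
    (smooth_on_derive_field U_open sc se2))) => x /set_mem Ux.
  have [w11 w12 w21 w22] := dual _ Ux.
  have [_] := codazzi x (e2 x) Ux; rewrite w12 w22 !mulr0 mulr1 subr0 => E.
  by rewrite /= [X in _ + X]E; ring.
have sNv : smooth_on U (\- v) := smooth_onN U_open sv.
pose n x := u x ^+ 2 + v x ^+ 2.
have sn : smooth_on U n.
  apply: (smooth_on_eq U_open) (smooth_onD U_open (smooth_onM U_open su su)
    (smooth_onM U_open sv sv)) => x _.
  by rewrite /n !expr2.
(* If [u] and [v] both vanish at a point, the sum of the two Codazzi equations makes the
   differential of [a' + c'] zero there, which is a critical point of the mean curvature. *)
have n0 x : U x -> 0 < n x.
  move=> Ux; rewrite lt_neqAle eq_sym addr_ge0 ?sqr_ge0// andbT.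
  apply/negP; rewrite /n paddr_eq0 ?sqr_ge0// !sqrf_eq0 => /andP[/eqP u0 /eqP v0].
  have [p pi px] := U_sub _ Ux.
  apply: (no_critical p); exists i => // xi; rewrite px.
  have [da dc] := (smooth_on_differentiable sa Ux, smooth_on_differentiable sc Ux).
  have -> : mean_curvature a c \o local_param i = 2^-1 *: (a' + c').
    by apply/funext => y; rewrite /mean_curvature !fctE/= mulrC.
  rewrite (deriveZ _ (derivableD (diff_derivable da) (diff_derivable dc))).
  rewrite (deriveD (diff_derivable da) (diff_derivable dc)).
  have [E1 E2] := codazzi x xi Ux.
  suff -> : 'D_xi a' x + 'D_xi c' x = 0 by rewrite scaler0.
  apply: (mulfI (invr_neq0 (ac_neq0 _ Ux))); rewrite mulr0 mulrDr.
  move: E1 E2; rewrite u0 v0 => /eqP + /eqP.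
  rewrite !subr_eq => /eqP E1 /eqP E2.
  by rewrite [X in X + _]E1 [X in _ + X]E2; ring.
have n_neq0 x : U x -> n x != 0 by move=> Ux; rewrite gt_eqF// n0.
pose G x := ln (a' x - c' x) - ln (n x).
have sG : smooth_on U G.
  exact: (smooth_onB U_open (smooth_on_ln U_open ac0 sac) (smooth_on_ln U_open n0 sn)).
have salpha1 xi : smooth_on U (fun x => alpha1 w1 w2 u v x xi).
  exact: (smooth_onD U_open (smooth_onM U_open su (sw1 xi))
    (smooth_onM U_open sNv (sw2 xi))).
(* The differential of [ln n], that is, twice that of [log A]. *)
pose m x xi := (n x)^-1 * (2 * (u x * 'D_xi u x + v x * 'D_xi v x)).
have Dlnn x xi : U x -> 'D_xi (fun y => ln (n y)) x = m x xi.
  move=> Ux; have dn := smooth_on_differentiable sn Ux.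
  have [_ ->] := derive_comp_real xi dn (is_derive1_ln (n0 _ Ux)).
  have du : derivable u x xi by exact/diff_derivable/(smooth_on_differentiable su Ux).
  have dv : derivable v x xi by exact/diff_derivable/(smooth_on_differentiable sv Ux).
  have -> : n = u * u + v * v by apply/funext => y; rewrite /n !fctE !expr2.
  rewrite /m (deriveD (derivableM du du) (derivableM dv dv)).
  rewrite (deriveM du du) (deriveM dv dv).
  by rewrite /GRing.scale/= !fctE -!expr2 /n; ring.
(* The difference of the Codazzi equations yields the differential of [ln (a' - c')]; the term
   [h * w2 - k * w1] is [star] of the connection form. *)
have DG x xi : U x -> 'D_xi G x = alpha1 w1 w2 u v x xi
    + 2 * (h x * w2 x xi - k x * w1 x xi) - m x xi.
  move=> Ux.
  have dac := smooth_on_differentiable sac Ux.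
  have dn := smooth_on_differentiable sn Ux.
  have [d1 D1] := derive_comp_real xi dac (is_derive1_ln (ac0 _ Ux)).
  have [d2 _] := derive_comp_real xi dn (is_derive1_ln (n0 _ Ux)).
  rewrite /G (deriveB (diff_derivable d1) (diff_derivable d2)) Dlnn// D1.
  congr (_ - _).
  have da : derivable a' x xi by exact/diff_derivable/(smooth_on_differentiable sa Ux).
  have dc : derivable c' x xi by exact/diff_derivable/(smooth_on_differentiable sc Ux).
  rewrite (deriveB da dc) mulrBr.
  have [/eqP E1 /eqP E2] := codazzi x xi Ux; move: E1 E2.
  rewrite !subr_eq => /eqP E1 /eqP E2.
  by rewrite [X in X - _]E1 [X in _ - X]E2 /alpha1 /lc/=; ring.
(* Both sides of each equation of two-forms are evaluated at the frame, and [frame_algebra] solves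
   the resulting system; [derive_angle] turns its last two conclusions into derivatives of [psi]. *)
have key x : U x ->
    [/\ theta12 x (e1 x) = 2 * h x - v x - m x (e2 x),
        theta12 x (e2 x) = 2 * k x - u x + m x (e1 x),
        2 * 'D_(e1 x) psi x = theta12 x (e1 x) - v x
      & 2 * 'D_(e2 x) psi x = theta12 x (e2 x) - u x].
  move=> Ux; have [w11 w12 w21 w22] := dual _ Ux.
  have E1 := dalpha1 x Ux (e1 x) (e2 x); have E2 := dalpha2 x Ux (e1 x) (e2 x).
  have [_ /(_ x Ux (e1 x) (e2 x)) E3 /(_ x Ux (e1 x) (e2 x)) E4] := theta12_conn.
  rewrite (d1_lc_coframe coframe w12_conn) in E1 => //.
  rewrite (d1_lc_coframe coframe w12_conn) in E2 => //.
  rewrite (d1_lc_coframe coframe w12_conn) in E3 => //.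
  rewrite (d1_lc_coframe coframe w12_conn) in E4 => //.
  have DNv xi : 'D_xi (\- v) x = - 'D_xi v x.
    by rewrite deriveN//; exact/diff_derivable/(smooth_on_differentiable sv Ux).
  rewrite DNv in E1; rewrite DNv in E4.
  rewrite /wedge1 /alpha1 /alpha2 /theta1 /theta2 /lc w11 w12 w21 w22 /= in E1 E2 E3 E4.
  have two0 : (2 : R) != 0 by rewrite pnatr_eq0.
  have [||||P Q P1 P2] := @frame_algebra R (u x) (v x) (h x) (k x)
    (theta12 x (e1 x)) (theta12 x (e2 x)) ('D_(e1 x) u x) ('D_(e2 x) u x)
    ('D_(e1 x) v x) ('D_(e2 x) v x) (n_neq0 _ Ux) two0.
  - by rewrite -[RHS]E1; ring.
  - rewrite E2; ring.
  - by rewrite E3; ring.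
  - move: E4 => /eqP; rewrite -subr_eq0 => /eqP E4.
    by apply/eqP; rewrite -subr_eq0 -E4; apply/eqP; ring.
  split=> //; apply: (mulfI (n_neq0 _ Ux)); rewrite mulrCA /n.
  - by rewrite (derive_angle _ U_open su sv psi_angle Ux).
  - by rewrite (derive_angle _ U_open su sv psi_angle Ux).
(* [m x] is linear in the direction, so it expands in the coframe. *)
have m_frame x xi : U x -> m x xi = m x (e1 x) * w1 x xi + m x (e2 x) * w2 x xi.
  move=> Ux; apply: (@form1_frameE _ _ _ _ _ _ coframe m) => // r y z /=.
  have lD f : smooth_on U f -> 'D_(r *: y + z) f x = r * 'D_y f x + 'D_z f x.
    move=> sf; have df := smooth_on_differentiable sf Ux.
    by rewrite !deriveE// linearP.
  by rewrite /m !lD//; ring.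
have star_theta12 x xi : U x -> d0 G x xi = star e1 e2 w1 w2 theta12 x xi.
  move=> Ux; have [P Q _ _] := key _ Ux.
  by rewrite /d0 DG// m_frame// /star P Q /alpha1 /lc/=; ring.
split; last exact: closed_form1_eq star_theta12 (closed_d0 U_open sG).
(* By [key], [star] of the differential of [psi] is half of [star] of [theta12] plus half of
   [alpha1]. The first is exact with potential [G], the second is closed by hypothesis. *)
apply: (closed_form1_eq U_open) (closed_form1_lc_cst 2^-1 2^-1 _ salpha1
  (closed_d0 U_open sG) dalpha1); last by move=> xi; exact: smooth_on_derive.
move=> x xi Ux; rewrite /lc star_theta12// /star /alpha1 /lc/=.
have [_ _ P Q] := key _ Ux.
have two0 : (2 : R) != 0 by rewrite pnatr_eq0.
apply: (mulfI two0); rewrite mulrDr !mulVKf// mulrBr !mulrA P Q; ring.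
Qed.
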